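(* Let $K$ be a field and let $G$ be a finite simple graph without isolated vertices and with more than one edge. Then the ideal $I(G)^2$ is not Cohen--Macaulay in each of the following cases: 1. $G$ is a whiskered graph (based on a finite simple graph without isolated vertices); 2. $G$ is a tree; 3. $G$ is a connected chordal graph; 4. $G$ is a connected Cohen--Macaulay bipartite graph.
   Context: For a finite simple graph $G$ with vertex set $V$ and edge set $E(G)$, the edge ideal $I(G)\subseteq S=K[v : v\in V]$ is generated by the monomials $vw$ with $\{v,w\}\in E(G)$. An ideal $J\subseteq S$ is called Cohen--Macaulay if $S/J$ is a Cohen--Macaulay ring; a graph $G$ is called Cohen--Macaulay (over $K$) if $I(G)$ is Cohen--Macaulay. Given a finite simple graph $H$ on vertices $x_1,\ldots,x_n$, the whiskered graph based on $H$ is the graph on $x_1,\ldots,x_n,y_1,\ldots,y_n$ whose edges are the edges of $H$ together with $\{x_1,y_1\},\ldots,\{x_n,y_n\}$. A graph is chordal if every cycle of length at least $4$ has a chord. *)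

(* Defs.v *)
From HB Require Import structures.
From mathcomp Require Import mpoly boolp.
From mathcomp Require Import all_boot all_order all_algebra.
From mathcomp Require Import generic_quotient ring_quotient ring.

Set Implicit Arguments.
Unset Strict Implicit.
Unset Printing Implicit Defensive.

Import GRing.Theory.
Local Open Scope ring_scope.
Local Open Scope quotient_scope.

(** * Ideals *)

(* In MathComp ideals are boolean predicates, and [idealr R] and
   [prime_idealr R] only contain proper ideals. Since [asbool] turns any
   proposition into a boolean, they range over all proper (resp. prime)
   ideals of R. *)

Section Ideals.
Variable R : comNzRingType.

Definition ideal_span (X : {pred R}) : {pred R} :=
  fun x => `[< exists2 t : seq (R * R),
                 {in t, forall q, q.2 \in X} & x = \sum_(q <- t) q.1 * q.2 >].

Definition ideal_mul (I J : {pred R}) : {pred R} :=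
  ideal_span (fun x => `[< exists u v, [/\ u \in I, v \in J & x = u * v] >]).

Lemma ideal_spanP (X : {pred R}) x :
  reflect (exists2 t : seq (R * R),
             {in t, forall q, q.2 \in X} & x = \sum_(q <- t) q.1 * q.2)
          (x \in ideal_span X).
Proof. exact: asboolP. Qed.

Lemma ideal_span_closed (X : {pred R}) :
  1 \notin ideal_span X -> idealr_closed (ideal_span X).
Proof.
split=> //; first by apply/ideal_spanP; exists [::]; rewrite ?big_nil.
move=> a u v /ideal_spanP[s sX ->] /ideal_spanP[t tX ->].
apply/ideal_spanP; exists ([seq (a * q.1, q.2) | q <- s] ++ t).
  move=> q; rewrite mem_cat => /orP[/mapP[r rs ->] /=|]; last exact: tX.
  exact: sX.
rewrite big_cat big_map /= mulr_sumr; congr (_ + _).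
by apply: eq_bigr => q _; rewrite mulrA.
Qed.

Lemma ideal_span_sub (X : {pred R}) (I : idealr R) :
  {subset X <= (I : pred R)} -> {subset ideal_span X <= (I : pred R)}.
Proof.
move=> sXI x /ideal_spanP[t tX ->]; rewrite big_seq.
by apply: rpred_sum => q qt; apply/idealMr/sXI/tX.
Qed.

Lemma ideal_mul_closed (I J : idealr R) : idealr_closed (ideal_mul I J).
Proof.
apply: ideal_span_closed; apply/negP => /(@ideal_span_sub _ J).
rewrite idealr1 => H; suff: false by [].
by apply: H => x /asboolP[u [v [_ vJ ->]]]; apply: idealMr.
Qed.

HB.instance Definition _ (I J : idealr R) :=
  isIdealr.Build R (ideal_mul I J) (ideal_mul_closed I J).

End Ideals.

(** * Localization at a prime ideal *)

Section Localization.
Variables (R : comNzRingType) (P : prime_idealr R).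

Record denom := Denom { den : R; den_notin : den \notin (P : pred R) }.
HB.instance Definition _ := [isSub for den].
HB.instance Definition _ := [Choice of denom by <:].

Implicit Types (x y z : R * denom) (s t : denom).

Lemma denom1_subproof : 1 \notin (P : pred R).
Proof. by rewrite idealr1. Qed.

Lemma denomM_subproof s t : den s * den t \notin (P : pred R).
Proof. by rewrite prime_idealrM negb_or (den_notin s) (den_notin t). Qed.

Definition denom1 : denom := Denom denom1_subproof.
Definition denomM s t : denom := Denom (denomM_subproof s t).

Definition loc_equiv x y : bool :=
  `[< exists u : denom, den u * (x.1 * den y.2) = den u * (y.1 * den x.2) >].

Lemma loc_equivP x y :
  reflect (exists u : denom, den u * (x.1 * den y.2) = den u * (y.1 * den x.2))
          (loc_equiv x y).
Proof. exact: asboolP. Qed.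

Lemma loc_equiv_refl : reflexive loc_equiv.
Proof. by move=> x; apply/loc_equivP; exists denom1. Qed.

Lemma loc_equiv_sym : symmetric loc_equiv.
Proof.
by move=> x y; apply/loc_equivP/loc_equivP => -[u Hu]; exists u.
Qed.

Lemma loc_equiv_trans : transitive loc_equiv.
Proof.
move=> y x z /loc_equivP[u Hu] /loc_equivP[v Hv]; apply/loc_equivP.
exists (denomM (denomM u v) y.2) => /=.
transitivity (den v * den z.2 * (den u * (x.1 * den y.2))); first by ring.
rewrite Hu; transitivity (den u * den x.2 * (den v * (y.1 * den z.2))).
  by ring.
by rewrite Hv; ring.
Qed.

Canonical loc_equiv_equiv :=
  EquivRel loc_equiv loc_equiv_refl loc_equiv_sym loc_equiv_trans.

Definition localization := {eq_quot loc_equiv}.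
HB.instance Definition _ : EqQuotient _ loc_equiv localization :=
  EqQuotient.on localization.
HB.instance Definition _ := Choice.on localization.

Definition loc_frac (a : R) (s : denom) : localization :=
  \pi_localization (a, s).

Lemma loc_fracP a b s t :
  reflect (exists u : denom, den u * (a * den t) = den u * (b * den s))
          (loc_frac a s == loc_frac b t).
Proof. by rewrite /loc_frac eqmodE; apply: (iffP (loc_equivP _ _)). Qed.

Lemma loc_fracW (Q : localization -> Prop) :
  (forall a s, Q (loc_frac a s)) -> forall l, Q l.
Proof. by move=> H; elim/quotW => -[a s]; exact: H. Qed.

Definition loc_add (l m : localization) : localization :=
  let: (x, y) := (repr l, repr m) in
  loc_frac (x.1 * den y.2 + y.1 * den x.2) (denomM x.2 y.2).
Definition loc_mul (l m : localization) : localization :=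
  let: (x, y) := (repr l, repr m) in loc_frac (x.1 * y.1) (denomM x.2 y.2).
Definition loc_opp (l : localization) : localization :=
  loc_frac (- (repr l).1) (repr l).2.

Lemma loc_reprP a s :
  exists u : denom, den u * (a * den (repr (loc_frac a s)).2)
                    = den u * ((repr (loc_frac a s)).1 * den s).
Proof.
apply/loc_fracP; rewrite {2}/loc_frac.
by rewrite -surjective_pairing reprK.
Qed.

Lemma loc_addE a b s t :
  loc_add (loc_frac a s) (loc_frac b t)
  = loc_frac (a * den t + b * den s) (denomM s t).
Proof.
rewrite /loc_add; have [u Hu] := loc_reprP a s; have [v Hv] := loc_reprP b t.
set x := repr _ in Hu *; set y := repr _ in Hv *.
apply/eqP/loc_fracP; exists (denomM u v) => /=.
transitivity (den v * den y.2 * den t * (den u * (x.1 * den s))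
            + den u * den x.2 * den s * (den v * (y.1 * den t))); first by ring.
by rewrite -Hu -Hv; ring.
Qed.

Lemma loc_mulE a b s t :
  loc_mul (loc_frac a s) (loc_frac b t) = loc_frac (a * b) (denomM s t).
Proof.
rewrite /loc_mul; have [u Hu] := loc_reprP a s; have [v Hv] := loc_reprP b t.
set x := repr _ in Hu *; set y := repr _ in Hv *.
apply/eqP/loc_fracP; exists (denomM u v) => /=.
transitivity ((den u * (x.1 * den s)) * (den v * (y.1 * den t))); first by ring.
by rewrite -Hu -Hv; ring.
Qed.

Lemma loc_oppE a s : loc_opp (loc_frac a s) = loc_frac (- a) s.
Proof.
rewrite /loc_opp; have [u Hu] := loc_reprP a s.
set x := repr _ in Hu *; apply/eqP/loc_fracP; exists u.
by rewrite !mulNr !mulrN Hu.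
Qed.

Lemma loc_frac_eq a b s t : a * den t = b * den s -> loc_frac a s = loc_frac b t.
Proof. by move=> H; apply/eqP/loc_fracP; exists denom1; rewrite H. Qed.

Fact loc_addA : associative loc_add.
Proof.
elim/loc_fracW=> a s; elim/loc_fracW=> b t; elim/loc_fracW=> c r.
by rewrite !loc_addE; apply: loc_frac_eq => /=; ring.
Qed.

Fact loc_addC : commutative loc_add.
Proof.
elim/loc_fracW=> a s; elim/loc_fracW=> b t.
by rewrite !loc_addE; apply: loc_frac_eq => /=; ring.
Qed.

Fact loc_add0 : left_id (loc_frac 0 denom1) loc_add.
Proof.
by elim/loc_fracW=> a s; rewrite loc_addE; apply: loc_frac_eq => /=; ring.
Qed.

Fact loc_addN : left_inverse (loc_frac 0 denom1) loc_opp loc_add.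
Proof.
elim/loc_fracW=> a s; rewrite loc_oppE loc_addE.
by apply: loc_frac_eq => /=; ring.
Qed.

HB.instance Definition _ :=
  GRing.isZmodule.Build localization loc_addA loc_addC loc_add0 loc_addN.

Fact loc_mulA : associative loc_mul.
Proof.
elim/loc_fracW=> a s; elim/loc_fracW=> b t; elim/loc_fracW=> c r.
by rewrite !loc_mulE; apply: loc_frac_eq => /=; ring.
Qed.

Fact loc_mulC : commutative loc_mul.
Proof.
elim/loc_fracW=> a s; elim/loc_fracW=> b t.
by rewrite !loc_mulE; apply: loc_frac_eq => /=; ring.
Qed.

Fact loc_mul1 : left_id (loc_frac 1 denom1) loc_mul.
Proof.
by elim/loc_fracW=> a s; rewrite loc_mulE; apply: loc_frac_eq => /=; ring.
Qed.

Fact loc_mulD : left_distributive loc_mul +%R.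
Proof.
rewrite /GRing.add /=.
elim/loc_fracW=> a s; elim/loc_fracW=> b t; elim/loc_fracW=> c r.
by rewrite !(loc_addE, loc_mulE); apply: loc_frac_eq => /=; ring.
Qed.

Fact loc_1neq0 : loc_frac 1 denom1 != 0.
Proof.
apply/negP => /loc_fracP[u] /=; rewrite !mulr1 mulr0 => u0.
by have := den_notin u; rewrite u0 idealr0.
Qed.

HB.instance Definition _ := GRing.Zmodule_isComNzRing.Build localization
  loc_mulA loc_mulC loc_mul1 loc_mulD loc_1neq0.

End Localization.

(** * Cohen-Macaulay rings *)

Section CohenMacaulay.
Implicit Types R L : comNzRingType.

Definition noetherian R : Prop :=
  forall I : idealr R, exists s : seq R, (I : pred R) =i ideal_span [in s].

Definition maximal_ideal R (M : idealr R) : Prop :=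
  forall I : idealr R, {subset (M : pred R) <= (I : pred R)} ->
    (I : pred R) =i (M : pred R).

Definition local_ring_at L (M : idealr L) : Prop :=
  maximal_ideal M /\
  forall M' : idealr L, maximal_ideal M' -> (M' : pred L) =i (M : pred L).

Definition prime_chain R (d : nat) (P : nat -> prime_idealr R) : Prop :=
  forall i, (i < d)%N ->
    {subset (P i : pred R) <= (P i.+1 : pred R)} /\
    ~ {subset (P i.+1 : pred R) <= (P i : pred R)}.

Definition krull_dim_is R (d : nat) : Prop :=
  (exists P : nat -> prime_idealr R, prime_chain d P) /\
  (forall k (P : nat -> prime_idealr R), prime_chain k P -> (k <= d)%N).

Definition regular_sequence R (s : seq R) : Prop :=
  (forall i, (i < size s)%N -> forall a,
     a * s`_i \in ideal_span [in take i s] -> a \in ideal_span [in take i s]) /\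
  1 \notin ideal_span [in s].

Definition depth_is R (M : idealr R) (d : nat) : Prop :=
  (exists s : seq R,
     [/\ regular_sequence s, {subset s <= (M : pred R)} & size s = d]) /\
  (forall s : seq R, regular_sequence s -> {subset s <= (M : pred R)} ->
     (size s <= d)%N).

Definition cohen_macaulay_local L : Prop :=
  noetherian L /\
  exists2 M : idealr L, local_ring_at M &
    exists2 d, depth_is M d & krull_dim_is L d.

(* As in the Stacks project, the condition is imposed on all local rings R_P;
   imposing it only at the maximal ideals gives the same class of rings. *)
Definition cohen_macaulay_ring R : Prop :=
  noetherian R /\
  forall P : prime_idealr R, cohen_macaulay_local (localization P).

Definition cohen_macaulay_ideal R (J : idealr R) : Prop :=
  cohen_macaulay_ring {ideal_quot J}.

End CohenMacaulay.

(** * Graphs *)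

(* A graph on the vertex set V is given by its adjacency relation. *)

Section Graphs.
Variable V : finType.
Implicit Type e : rel V.

Definition simple_graph e : Prop := symmetric e /\ irreflexive e.

Definition no_isolated e : Prop := forall v, exists w, e v w.

Definition edges e : {set {set V}} :=
  [set [set p.1; p.2] | p : V * V & e p.1 p.2].

Definition connected e : Prop := forall v w, connect e v w.

Definition graph_cycle e (c : seq V) : Prop := ucycle e c /\ (2 < size c)%N.

Definition tree e : Prop :=
  connected e /\ forall c, ~ graph_cycle e c.

Definition chord e (c : seq V) (v w : V) : Prop :=
  [/\ v \in c, w \in c, e v w, next c v != w & next c w != v].

Definition chordal e : Prop :=
  forall c, graph_cycle e c -> (4 <= size c)%N -> exists v w, chord e c v w.

Definition bipartite e : Prop :=
  exists A : {set V}, forall v w, e v w -> (v \in A) != (w \in A).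

End Graphs.

(* The vertices x_i and y_i are [inl i] and [inr i]. *)
Definition whisker (W : finType) (h : rel W) : rel (W + W) := fun a b =>
  match a, b with
  | inl v, inl w => h v w
  | inl v, inr w | inr v, inl w => v == w
  | inr _, inr _ => false
  end.

Definition whiskered (V : finType) (e : rel V) : Prop :=
  exists (W : finType) (h : rel W),
    [/\ simple_graph h, no_isolated h
      & exists2 f : W + W -> V, bijective f &
          forall a b, e (f a) (f b) = whisker h a b].

(** * Edge ideals *)

Section EdgeIdeal.
Variables (K : fieldType) (V : finType) (e : rel V).

Definition vertex_var (v : V) : {mpoly K[#|V|]} := 'X_(enum_rank v).

Definition edge_ideal : {pred {mpoly K[#|V|]}} :=
  ideal_span (fun f =>
    [exists v, exists w, e v w && (f == vertex_var v * vertex_var w)]).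

Lemma edge_ideal_closed : idealr_closed edge_ideal.
Proof.
apply: ideal_span_closed; apply/negP => /ideal_spanP[t tX].
move/(congr1 (mcoeff 0%MM)); rewrite mcoeff1 eqxx raddf_sum big_seq big1 /=.
  by move/eqP; rewrite oner_eq0.
move=> q /tX /existsP[v /existsP[w /andP[_ /eqP->]]].
by rewrite !rmorphM /= !mcoeffX mnm1_eq0 mul0r mulr0.
Qed.

HB.instance Definition _ :=
  isIdealr.Build {mpoly K[#|V|]} edge_ideal edge_ideal_closed.

End EdgeIdeal.

Arguments edge_ideal K {V} e.

Definition cohen_macaulay_graph (K : fieldType) (V : finType) (e : rel V) : Prop :=
  cohen_macaulay_ideal (edge_ideal K e).

(* Main.v *)
(* Let [F] be an independent set and localize [S / I(G)^2] at the prime [P]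
   generated by the variables outside [F]; the neighbours of [F] then drop out,
   and the graph [H = G \ N[F]] is what remains.
   - If a triangle [xyz] dominates [H], then [P] annihilates the nonzero element
     [xyz] of the localization, which has positive dimension: its depth is 0.
   - If an edge [uv] dominates [H], then [P = Q1 + Q2], where [Q1] is generated
     by the neighbours of [u], and [Q1 Q2 uv] lies in [I^2]. A regular pair in
     [P] would glue [0] and [uv] into an element [c] with [Q1 c = 0] and
     [Q2 (c - uv) = 0], and no such [c] exists. So the depth is at most 1, while
     the dimension is at least 2 as soon as [H] has two nonadjacent vertices.
   A suitable [F] for the second criterion exists when some leaf has a neighbour
   of degree at least 2, as in trees and whiskered graphs, and for every
   connected bipartite graph with more than one edge. A chordal graph without
   triangles has no cycles. *)

From HB Require Import structures.
Require Import Defs.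
From mathcomp Require Import mpoly boolp.
From mathcomp Require Import all_boot all_order all_algebra.
From mathcomp Require Import generic_quotient ring_quotient ring.

Set Implicit Arguments.
Unset Strict Implicit.
Unset Printing Implicit Defensive.

Import GRing.Theory.
Local Open Scope ring_scope.
Local Open Scope quotient_scope.

(** * Generated ideals, and primes of a quotient ring *)

Lemma ideal_span_mem (R : comNzRingType) (A : {pred R}) a f :
  f \in A -> a * f \in ideal_span A.
Proof.
move=> fA; apply/ideal_spanP; exists [:: (a, f)]; last by rewrite big_seq1.
by move=> q; rewrite inE => /eqP ->.
Qed.

Lemma ideal_span1P (R : comNzRingType) (a x : R) :
  reflect (exists c, x = c * a) (x \in ideal_span [in [:: a]]).
Proof.
apply: (iffP (ideal_spanP _ _)) => [[t ta ->]|[c ->]].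
  exists (\sum_(q <- t) q.1); rewrite mulr_suml big_seq [RHS]big_seq.
  by apply: eq_bigr => q /ta; rewrite inE => /eqP ->.
exists [:: (c, a)]; rewrite ?big_seq1 // => q.
by rewrite inE => /eqP ->; exact: mem_head.
Qed.

Lemma ideal_span0 (R : comNzRingType) (x : R) :
  (x \in ideal_span [in [::]]) = (x == 0).
Proof.
apply/ideal_spanP/eqP => [[[|q t] ta ->]|->]; first by rewrite big_nil.
  by have := ta q (mem_head _ _).
by exists [::]; rewrite ?big_nil.
Qed.

Lemma prime_idealr_of (R : comNzRingType) (S : {pred R}) :
    idealr_closed S -> prime_idealr_closed S ->
  exists I : prime_idealr R, (I : pred R) =i S.
Proof.
move=> cS pS; pose m1 := isIdealr.Build R S cS.
pose m2 := isPrimeIdealrClosed.Build R S pS.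
by pose I : prime_idealr R := HB.pack (S : pred R) m1 m2; exists I.
Qed.

(** Membership is tested on the canonical representative; this depends only on the class because [Q]
    contains [J]. *)
Lemma quotient_prime (R : comNzRingType) (J : idealr R) (Q : prime_idealr R) :
    {subset (J : pred R) <= (Q : pred R)} ->
  exists Q' : prime_idealr {ideal_quot J},
    forall f, (\pi_({ideal_quot J}) f \in (Q' : pred _)) = (f \in (Q : pred R)).
Proof.
move=> JQ; pose S : {pred {ideal_quot J}} := fun x => repr x \in (Q : pred R).
have piS f : (\pi_({ideal_quot J}) f \in S) = (f \in (Q : pred R)).
  have /JQ h : repr (\pi_({ideal_quot J}) f) - f \in (J : pred R).
    by rewrite Quotient.idealrBE reprK.
  by rewrite unfold_in -[X in X \in _ = _](subrK f) rpredDl.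
have [||I IS] := @prime_idealr_of _ S.
- split.
  + by rewrite -(rmorph0 (\pi_({ideal_quot J}))) piS idealr0.
  + by rewrite -(rmorph1 (\pi_({ideal_quot J}))) piS idealr1.
  + elim/quotW=> a; elim/quotW=> b; elim/quotW=> c.
    by rewrite !piS -rmorphM -rmorphD piS => bQ cQ; rewrite rpredD // idealMr.
- elim/quotW=> a; elim/quotW=> b.
  by rewrite -rmorphM !piS prime_idealrM.
by exists I => f; rewrite IS piS.
Qed.

(** * Primes and units of a localization *)

Section LocalizationTheory.
Variables (R : comNzRingType) (P : prime_idealr R).
Local Notation L := (localization P).

(** The extension of [Q], tested on the numerator of a representative: as [Q] is prime and avoids
    all denominators, equal fractions give the same answer. *)
Lemma localization_prime (Q : prime_idealr R) :
    {subset (Q : pred R) <= (P : pred R)} ->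
  exists Q' : prime_idealr L,
    forall a s, (loc_frac a s \in (Q' : pred L)) = (a \in (Q : pred R)).
Proof.
move=> QP; have dQ (s : denom P) : (den s \in (Q : pred R)) = false.
  by apply/negP => /QP; apply/negP/den_notin.
pose S : {pred L} := fun l => (repr l).1 \in (Q : pred R).
have fracS a s : (loc_frac a s \in S) = (a \in (Q : pred R)).
  have [u] := loc_reprP a s; move/(congr1 (fun x => x \in (Q : pred R))).
  by rewrite !prime_idealrM !dQ /= !orbF.
have [||I IS] := @prime_idealr_of _ S.
- split.
  + by rewrite fracS idealr0.
  + by rewrite fracS idealr1.
  + elim/loc_fracW=> a r; elim/loc_fracW=> b s; elim/loc_fracW=> c t.
    rewrite /GRing.mul /GRing.add /= loc_mulE loc_addE !fracS => bQ cQ.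
    by rewrite rpredD // mulrC idealMr // idealMr.
- elim/loc_fracW=> a r; elim/loc_fracW=> b s.
  by rewrite /GRing.mul /= loc_mulE !fracS prime_idealrM.
by exists I => a s; rewrite IS fracS.
Qed.

Definition loc_map (a : R) : L := loc_frac a (denom1 P).

Lemma loc_map_is_zmod_morphism : zmod_morphism loc_map.
Proof.
move=> a b; rewrite /GRing.opp /GRing.add /= loc_oppE loc_addE.
by apply: loc_frac_eq; rewrite /= !mulr1.
Qed.

HB.instance Definition _ :=
  GRing.isZmodMorphism.Build R L loc_map loc_map_is_zmod_morphism.

Lemma loc_map_is_monoid_morphism : monoid_morphism loc_map.
Proof.
split=> // a b; rewrite /GRing.mul /= loc_mulE.
by apply: loc_frac_eq; rewrite /= !mulr1.
Qed.

HB.instance Definition _ :=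
  GRing.isMonoidMorphism.Build R L loc_map loc_map_is_monoid_morphism.

Lemma loc_map_eq0 a :
  loc_map a = 0 <-> exists2 t, t \notin (P : pred R) & t * a = 0.
Proof.
split=> [/eqP/loc_fracP[u]|[t tP ta]].
  by rewrite /= mul0r !mulr1 mulr0 => ua; exists (den u); rewrite ?den_notin.
by apply/eqP/loc_fracP; exists (Denom tP); rewrite /= mul0r mulr0 mulr1.
Qed.

Lemma loc_fracE a (s : denom P) :
  loc_frac a s = loc_frac 1 s * loc_map a.
Proof.
by rewrite /GRing.mul /= loc_mulE; apply: loc_frac_eq; rewrite /= mulr1 mul1r.
Qed.

Lemma loc_fracV (s : denom P) : loc_frac 1 s * loc_map (den s) = 1.
Proof.
by rewrite -loc_fracE; apply: loc_frac_eq; rewrite /= mulr1 mul1r.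
Qed.

(** A fraction whose numerator lies outside [P] is a unit, and members of [idealr] are proper. This
    controls the ideal [M] supplied by the depth condition. *)
Lemma maximal_idealS (I : idealr L) a s :
  loc_frac a s \in (I : pred L) -> a \in (P : pred R).
Proof.
move=> aI; apply: contraT => aP.
have := idealr1 I.
rewrite -(_ : loc_frac (den s) (Denom aP) * loc_frac a s = 1).
  by rewrite idealMr.
by rewrite /GRing.mul /= loc_mulE; apply: loc_frac_eq; rewrite /=; ring.
Qed.

End LocalizationTheory.

(** * Regular elements forced by the dimension *)

Section Depth.
Variable L : comNzRingType.
Hypothesis cmL : cohen_macaulay_local L.

(** Depth equals dimension, and a chain of length 1 makes both positive; the first term of a longest
    regular sequence is a nonzerodivisor. *)
Lemma cm_regular_element (P : nat -> prime_idealr L) : prime_chain 1 P ->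
  exists (M : idealr L) (a : L),
    a \in (M : pred L) /\ forall x, x * a = 0 -> x = 0.
Proof.
move=> chP; have [_ [M _ [d [[s [[s_reg _] sM sd]] _] [_ dmax]]]] := cmL.
have := dmax _ _ chP; rewrite -sd; case: s => // a s in s_reg sM sd * => _.
exists M, a; split=> [|x xa]; first exact/sM/mem_head.
by apply/eqP; rewrite -ideal_span0 (s_reg 0) //= xa ideal_span0.
Qed.

(** The analogue in dimension at least 2; the last clause spells out that [b] is regular modulo
    [a]. *)
Lemma cm_regular_pair (P : nat -> prime_idealr L) : prime_chain 2 P ->
  exists (M : idealr L) (a b : L),
    [/\ a \in (M : pred L), b \in (M : pred L),
        forall x, x * a = 0 -> x = 0
      & forall x y, x * b = y * a -> exists c, x = c * a].
Proof.
move=> chP; have [_ [M _ [d [[s [[s_reg _] sM sd]] _] [_ dmax]]]] := cmL.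
have := dmax _ _ chP; rewrite -sd.
case: s => [|a [|b s]] // in s_reg sM sd * => _.
exists M, a, b; split=> [||x xa|x y xy].
- exact/sM/mem_head.
- by apply: sM; rewrite !inE eqxx orbT.
- by apply/eqP; rewrite -ideal_span0 (s_reg 0) //= xa ideal_span0.
- apply/ideal_span1P; apply: (s_reg 1) => //=.
  by apply/ideal_span1P; exists y.
Qed.

End Depth.

(* If [a, b] lie in [Q1 + Q2] and [Q1 Q2 m = 0], then [b q2 m = a q2' m], so
   regularity yields an element [c] that is [0] modulo the annihilator of
   [Q1] and [m] modulo that of [Q2]. *)
Lemma regular_pair_glue (L : comNzRingType) (m q1 q2 q1' q2' : L) :
    q1 * q2' * m = 0 -> q1' * q2 * m = 0 ->
    (forall x, x * (q1 + q2) = 0 -> x = 0) ->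
    (forall x y, x * (q1' + q2') = y * (q1 + q2) ->
       exists c, x = c * (q1 + q2)) ->
  exists c, (forall r, r * q2 * m = 0 -> r * c = 0) /\
            (forall r, r * q1 * m = 0 -> r * c = r * m).
Proof.
move=> q12' q1'2 regA regB.
have [|c cE] := regB (q2 * m) (q2' * m).
  transitivity (q2' * m * (q1 + q2) + q1' * q2 * m - q1 * q2' * m).
    by ring.
  by rewrite q12' q1'2 subr0 addr0.
exists c; split=> r rm.
  apply: regA; transitivity (r * (c * (q1 + q2))); first by ring.
  by rewrite -cE mulrA.
apply/eqP; rewrite -subr_eq0; apply/eqP/regA.
transitivity (r * (c * (q1 + q2)) - r * q2 * m - r * q1 * m); first by ring.
by rewrite -cE rm mulrA subrr subr0.
Qed.

(** * Local rings of a quotient ring *)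

Section QuotientLocalization.
Variables (R : comNzRingType) (J : idealr R).
Variable P : prime_idealr {ideal_quot J}.
Local Notation L := (localization P).
Local Notation "\bar f" := (\pi_({ideal_quot J}) f) (at level 9).

Definition quot_loc : R -> L := loc_map P \o \pi_({ideal_quot J}).
HB.instance Definition _ :=
  GRing.RMorphism.copy quot_loc (loc_map P \o \pi_({ideal_quot J})).

Lemma quot_loc_eq0 f : quot_loc f = 0 <->
  exists2 t, \bar t \notin (P : pred _) & t * f \in (J : pred R).
Proof.
split=> [/loc_map_eq0[t]|[t tP tf]].
  elim/quotW: t => t tP; rewrite -rmorphM => tf; exists t => //.
  by rewrite -[t * f]subr0 Quotient.idealrBE tf rmorph0.
apply/loc_map_eq0; exists (\bar t) => //; rewrite -rmorphM; apply/eqP.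
by rewrite -(rmorph0 (\pi_({ideal_quot J}))) -Quotient.idealrBE subr0.
Qed.

(** Here [r] is the inverse of the image of the denominator [s], so that later computations take
    place in [R]. *)
Lemma quot_loc_frac (l : L) : exists f s r,
  [/\ \bar s \notin (P : pred _), r * quot_loc s = 1 & l = r * quot_loc f].
Proof.
elim/loc_fracW: l => a s; exists (repr a), (repr (den s)), (loc_frac 1 s).
by rewrite /quot_loc /= !reprK den_notin loc_fracV -loc_fracE.
Qed.

Lemma quot_loc_ideal (I : idealr L) f :
  quot_loc f \in (I : pred L) -> \bar f \in (P : pred _).
Proof. exact: maximal_idealS. Qed.

Lemma quot_loc_prime (Q : prime_idealr R) :
    {subset (J : pred R) <= (Q : pred R)} ->
    (forall f, f \in (Q : pred R) -> \bar f \in (P : pred _)) ->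
  exists Q' : prime_idealr L,
    forall r s f, r * quot_loc s = 1 ->
       (r * quot_loc f \in (Q' : pred L)) = (f \in (Q : pred R)).
Proof.
move=> JQ QP; have [Q1 Q1E] := quotient_prime JQ.
have [|Q2 Q2E] := @localization_prime _ P Q1.
  by elim/quotW=> a; rewrite Q1E; apply: QP.
exists Q2 => r s f rs; rewrite prime_idealrM /quot_loc /= Q2E Q1E.
suff /negPf-> : r \notin (Q2 : pred L) by [].
apply/negP => rQ; have := idealr1 Q2.
by rewrite -rs mulrC idealMr.
Qed.

(** Bounds the dimension of the local ring from below by chains of primes of [R] lying between [J]
    and the preimage of [P]. *)
Lemma quot_loc_chain d (Q : nat -> prime_idealr R) :
    prime_chain d Q ->
    (forall i, {subset (J : pred R) <= (Q i : pred R)}) ->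
    (forall i f, f \in (Q i : pred R) -> \bar f \in (P : pred _)) ->
  exists Q' : nat -> prime_idealr L, prime_chain d Q'.
Proof.
move=> chQ JQ QP.
have [Q' Q'E] := choice (fun i => quot_loc_prime (JQ i) (QP i)).
exists Q' => i /chQ[sQ nQ]; split.
  move=> l; have [f [s [r [_ rs ->]]]] := quot_loc_frac l.
  by rewrite !(Q'E _ _ _ _ rs); apply: sQ.
move=> sQ'; apply: nQ => f; have := sQ' (1 * quot_loc f).
by rewrite !(Q'E _ _ 1) ?rmorph1 ?mulr1.
Qed.

End QuotientLocalization.

(** * Substitutions, and primes generated by variables *)

Section Substitution.
Variables (K : fieldType) (V : finType).
Local Notation S := {mpoly K[#|V|]}.
Local Notation X := (@vertex_var K V).

Lemma vertex_ind (Q : S -> Prop) :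
    (forall c, Q c%:MP) -> (forall v, Q (X v)) ->
    (forall f g, Q f -> Q g -> Q (f + g)) ->
    (forall f g, Q f -> Q g -> Q (f * g)) ->
  forall f, Q f.
Proof.
move=> QC QX QD QM f; rewrite (mpolyE f).
apply: (big_ind Q) => [||m _]; [by rewrite -mpolyC0 | exact: QD |].
rewrite -mul_mpolyC; apply: (QM); first exact: (QC).
rewrite mpolyXE_id.
apply: (big_ind Q) => [||i _]; [exact: (QC 1) | exact: QM |].
elim: (m i) => [|k IHk]; first exact: (QC 1).
by rewrite exprS; apply: (QM) => //; rewrite -[i]enum_valK; apply: QX.
Qed.

Definition subst (h : V -> S) : S -> S :=
  mmap (@mpolyC #|V| K) (fun i => h (enum_val i)).
HB.instance Definition _ h := GRing.RMorphism.copy (subst h)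
  (mmap (@mpolyC #|V| K) (fun i => h (enum_val i))).

Lemma substX h v : subst h (X v) = h v.
Proof. by rewrite /subst mmapX mmap1U enum_rankK. Qed.

Lemma substC h c : subst h c%:MP = c%:MP.
Proof. by rewrite /subst mmapC. Qed.

Lemma subst_comp (h g k : V -> S) :
  (forall v, subst h (g v) = k v) -> forall f, subst h (subst g f) = subst k f.
Proof.
move=> hg; elim/vertex_ind => [c|v|f1 f2 E1 E2|f1 f2 E1 E2].
- by rewrite !substC.
- by rewrite !substX hg.
- by rewrite !rmorphD /= E1 E2.
- by rewrite !rmorphM /= E1 E2.
Qed.

(** Reduction modulo the variables in [C], realised as an endomorphism of [S]; by [kill_decomp] its
    kernel is the ideal that they generate. *)
Definition kill (C : {set V}) : S -> S :=
  subst (fun v => if v \in C then 0 else X v).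
HB.instance Definition _ C := GRing.RMorphism.copy (kill C)
  (subst (fun v => if v \in C then 0 else X v)).

Lemma killX C v : kill C (X v) = if v \in C then 0 else X v.
Proof. exact: substX. Qed.

Lemma kill_kill (C D : {set V}) f : C \subset D -> kill D (kill C f) = kill D f.
Proof.
move=> /subsetP CD; apply: subst_comp => v.
by have [/CD ->|_] := boolP (v \in C); rewrite ?rmorph0 ?substX.
Qed.

Lemma vertex_var_neq0 v : X v != 0.
Proof.
apply/eqP => /(congr1 (mcoeff U_(enum_rank v)%MM)).
by rewrite mcoeffX eqxx mcoeff0; apply/eqP/oner_neq0.
Qed.

Lemma kill_decomp C f :
  exists k : V -> S, f = kill C f + \sum_(v in C) k v * X v.
Proof.
elim/vertex_ind: f => [c|v|f g [k Ef] [l Eg]|f g [k Ef] [l Eg]].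
- exists (fun=> 0); rewrite /kill substC big1 ?addr0 // => v _.
  exact: mul0r.
- exists (fun w => (w == v)%:R); rewrite killX; case: ifPn => vC.
    rewrite add0r (bigD1 v) //= eqxx mul1r.
    rewrite big1 ?addr0 // => w /andP[_ /negPf->].
    exact: mul0r.
  rewrite big1 ?addr0 // => w wC; case: eqP => [wv|]; last by rewrite mul0r.
  by rewrite -wv wC in vC.
- exists (fun v => k v + l v); rewrite {1}Ef {1}Eg rmorphD /=.
  under [in RHS]eq_bigr do rewrite mulrDl.
  by rewrite big_split /= addrACA.
(* Expand [f] first, then expand [g] in the remaining term [kill C f * g] only. *)
- exists (fun v => k v * g + kill C f * l v); rewrite {1}Ef rmorphM /=.
  under [in RHS]eq_bigr do rewrite mulrDl mulrAC -[kill C f * _ * _]mulrA.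
  rewrite big_split /= -mulr_suml -mulr_sumr.
  rewrite mulrDl [kill C f * g](_ : _ =
    kill C f * (kill C g + \sum_(v in C) l v * X v)).
    by rewrite mulrDr -addrA; congr (_ + _); rewrite addrC.
  by rewrite -Eg.
Qed.

(** The kernel of an endomorphism of a domain is prime. *)
Lemma vars_prime (C : {set V}) :
  exists Q : prime_idealr S, forall f, (f \in (Q : pred S)) = (kill C f == 0).
Proof.
have [||Q QE] := @prime_idealr_of S (fun f => kill C f == 0).
- split; rewrite ?unfold_in ?rmorph0 ?rmorph1 ?oner_eq0 // => a f g.
  rewrite !unfold_in => /eqP f0 /eqP g0.
  by rewrite rmorphD rmorphM /= f0 g0 mulr0 addr0.
- by move=> f g; rewrite !unfold_in rmorphM /= mulf_eq0.
by exists Q => f; rewrite QE unfold_in.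
Qed.

End Substitution.

(** * The square of the edge ideal *)

Section EdgeIdealSquare.
Variables (K : fieldType) (V : finType) (e : rel V).
Local Notation S := {mpoly K[#|V|]}.
Local Notation X := (@vertex_var K V).
Local Notation I := (edge_ideal K e).
Local Notation J := (ideal_mul I I).

Lemma edge_mem v w : e v w -> X v * X w \in I.
Proof.
move=> vw; rewrite -[_ * _]mul1r; apply: ideal_span_mem.
by apply/existsP; exists v; apply/existsP; exists w; rewrite vw eqxx.
Qed.

Lemma edge_sq_mem a f v w v' w' : e v w -> e v' w' ->
  f = a * (X v * X w * (X v' * X w')) -> f \in J.
Proof.
move=> vw vw' ->; apply: ideal_span_mem; apply/asboolP.
by exists (X v * X w), (X v' * X w'); split; rewrite ?edge_mem.
Qed.

Lemma edge_idealS (Q : idealr S) :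
    (forall v w, e v w -> X v * X w \in (Q : pred S)) ->
  {subset (J : pred S) <= (Q : pred S)}.
Proof.
move=> QX; apply: ideal_span_sub => f /asboolP[g [h [_ hI ->]]].
apply: idealMr; move: h hI; apply: ideal_span_sub => h.
by case/existsP=> v /existsP[w /andP[vw /eqP->]]; apply: QX.
Qed.

(** Divisibility of images by a fixed element passes from generators to the ideal they span;
    [span_dvd] is applied to [I] with [T ^+ 2], then to [J] with [T ^+ 4]. *)
Lemma edge_sq_morph (phi : {rmorphism S -> S}) T :
    (forall v w, e v w -> exists k, phi (X v * X w) = k * T ^+ 2) ->
  forall f, f \in J -> exists k, phi f = k * T ^+ 4.
Proof.
move=> phiX.
have span_dvd (A : {pred S}) N :
    (forall f, f \in A -> exists k, phi f = k * N) ->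
    forall f, f \in ideal_span A -> exists k, phi f = k * N.
  move=> AN f /ideal_spanP[t tA ->]; elim: t tA => [|q t IHt] tA.
    by exists 0; rewrite big_nil rmorph0 mul0r.
  have [|k Ek] := IHt; first by move=> r rt; apply: tA; rewrite inE rt orbT.
  have [l El] := AN _ (tA _ (mem_head _ _)).
  exists (phi q.1 * l + k); rewrite big_cons rmorphD rmorphM /= Ek El.
  by ring.
have phiI f : f \in I -> exists k, phi f = k * T ^+ 2.
  apply: span_dvd => g /existsP[v /existsP[w /andP[vw /eqP->]]].
  exact: phiX.
apply: span_dvd => f /asboolP[g [h [/phiI[k Ek] /phiI[l El] ->]]].
by exists (k * l); rewrite rmorphM Ek El; ring.
Qed.

End EdgeIdealSquare.

(** * Independent sets *)

Definition independent (V : finType) (e : rel V) (F : {set V}) : Prop :=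
  {in F &, forall v w, ~~ e v w}.

Lemma independentS (V : finType) (e : rel V) (F G : {set V}) :
  F \subset G -> independent e G -> independent e F.
Proof. by move=> /subsetP FG iG v w /FG vG /FG; apply: iG. Qed.

Lemma independentU1 (V : finType) (e : rel V) (p : V) (F : {set V}) :
    simple_graph e -> independent e F -> {in F, forall w, ~~ e w p} ->
  independent e (p |: F).
Proof.
move=> [esym eirr] iF Fp v w /setU1P[->|vF] /setU1P[->|wF].
- by rewrite eirr.
- by rewrite esym Fp.
- exact: Fp.
- exact: iF.
Qed.

(** * Local obstructions from a dominating triangle or edge *)

Section LocalCriteria.
Variables (K : fieldType) (V : finType) (e : rel V).
Hypothesis e_simple : simple_graph e.
Local Notation S := {mpoly K[#|V|]}.
Local Notation X := (@vertex_var K V).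
Local Notation I := (edge_ideal K e).
Local Notation J := (ideal_mul I I).
Local Notation Ji := (ideal_mul I I : idealr S).
Local Notation "\bar f" := (\pi_({ideal_quot Ji}) f) (at level 9).

(** For independent [G i] containing [F], the variables outside [G i] generate a prime that contains
    [J], since every edge has an end outside [G i], and that maps into [P]. Shrinking [G i] enlarges
    this prime. *)
Lemma independent_local (F : {set V}) : independent e F ->
  exists P : prime_idealr {ideal_quot Ji},
    (forall f, (\bar f \in (P : pred _)) = (kill (~: F) f == 0)) /\
    (forall d (G : nat -> {set V}),
       (forall i, F \subset G i) -> (forall i, independent e (G i)) ->
       (forall i, (i < d)%N -> G i.+1 \proper G i) ->
     exists Q : nat -> prime_idealr (localization P), prime_chain d Q).
Proof.
have kill_edge (G : {set V}) v w : independent e G -> e v w ->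
    kill (~: G) (X v * X w) = 0.
  move=> iG vw; rewrite rmorphM /= !killX !inE.
  have [vG|_] := boolP (v \in G); last by rewrite mul0r.
  have [wG|_] := boolP (w \in G); last by rewrite mulr0.
  by have := iG _ _ vG wG; rewrite vw.
have JS G (Q : prime_idealr S) : independent e G ->
    (forall f, (f \in (Q : pred S)) = (kill (~: G) f == 0)) ->
    {subset (J : pred S) <= (Q : pred S)}.
  by move=> iG QE; apply: edge_idealS => v w vw; rewrite QE kill_edge.
move=> iF; have [QF QFE] := vars_prime K (~: F).
have [P PE] := quotient_prime (JS _ _ iF QFE : {subset (Ji : pred S) <= _}).
exists P; split=> [f|d G FG iG properG]; first by rewrite PE QFE.
have [Q QE] := choice (fun i => vars_prime K (~: G i)).
apply: (@quot_loc_chain _ _ _ _ Q) => [i ltid|i|i f]; first last.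
- rewrite QE PE QFE => /eqP f0.
  by rewrite -(@kill_kill _ _ (~: G i)) ?setCS // f0 rmorph0.
- exact: JS (iG i) (QE i).
have /properP[sG [v vG vG']] := properG _ ltid; split.
  move=> f; rewrite !QE => /eqP f0.
  by rewrite -(@kill_kill _ _ (~: G i)) ?setCS // f0 rmorph0.
move/(_ (X v)); rewrite !QE !killX !inE vG vG' eqxx => /(_ isT).
by rewrite (negPf (vertex_var_neq0 K v)).
Qed.

(* Contracting [D] to [u] turns [I^2] into multiples of [u^4], so an element of
   lower degree supported on [D] survives in the localization at [P]. *)
Lemma contract_core (F D : {set V}) u :
    independent e F -> {in F & D, forall v w, ~~ e v w} ->
    [disjoint D & F] -> u \in D ->
  exists phi : {rmorphism S -> S},
    [/\ {in D, forall v, phi (X v) = X u},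
        forall f, f \in J -> exists k, phi f = k * X u ^+ 4
      & forall f, kill (~: F) (phi f) = kill (~: F) f].
Proof.
move=> iF FD dDF uD; have [esym _] := e_simple.
pose h v := if v \in F then X v else if v \in D then X u else 0.
have hD v : v \in D -> h v = X u.
  by move=> vD; rewrite /h (disjointFr dDF vD) vD.
exists (subst h); split=> [v vD|f|f].
- by rewrite /= substX hD.
- apply: edge_sq_morph => v w vw; rewrite rmorphM /= !substX /h.
  case: (boolP (v \in F)) => vF; case: (boolP (w \in F)) => wF.
  + by have := iF _ _ vF wF; rewrite vw.
  + case: (boolP (w \in D)) => wD; last by exists 0; rewrite mulr0 mul0r.
    by have := FD _ _ vF wD; rewrite vw.
  + case: (boolP (v \in D)) => vD; last by exists 0; rewrite !mul0r.
    by have := FD _ _ wF vD; rewrite esym vw.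
  + case: (boolP (v \in D)) => vD; last by exists 0; rewrite !mul0r.
    case: (boolP (w \in D)) => wD; last by exists 0; rewrite mulr0 mul0r.
    by exists 1; rewrite mul1r expr2.
- apply: subst_comp => v; rewrite /h inE.
  case: (boolP (v \in F)) => vF; first by rewrite substX inE vF.
  case: (boolP (v \in D)) => vD; last by rewrite rmorph0.
  by rewrite substX inE (disjointFr dDF uD).
Qed.

(** Up to a unit, [a] is the image of a polynomial that vanishes when the variables outside [F] are
    set to zero, so [kill_decomp] applies. *)
Lemma local_decomp (F : {set V}) (P : prime_idealr {ideal_quot Ji})
    (PE : forall f, (\bar f \in (P : pred _)) = (kill (~: F) f == 0))
    (M : idealr (localization P)) a :
  a \in (M : pred _) ->
  exists r (k : V -> S), a = r * quot_loc P (\sum_(w in ~: F) k w * X w).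
Proof.
have [f [s [r [_ rs ->]]]] := quot_loc_frac a => aM.
have : quot_loc P f \in (M : pred _).
  by rewrite -[quot_loc P f]mul1r -rs mulrAC mulrC idealMr.
move/quot_loc_ideal; rewrite PE => /eqP f0.
by have [k Ek] := kill_decomp (~: F) f; exists r, k; rewrite {1}Ek f0 add0r.
Qed.

Lemma triangle_not_cm (F : {set V}) x y z :
    e x y -> e y z -> e z x -> independent e F ->
    {in F, forall w, [&& ~~ e w x, ~~ e w y & ~~ e w z]} ->
    (forall w, w \notin F ->
       [|| e w x, e w y, e w z | [exists t in F, e t w]]) ->
  ~ cohen_macaulay_ideal Ji.
Proof.
move=> xy yz zx iF Fxyz domF [_ cmS]; have [esym eirr] := e_simple.
have [P [PE chainP]] := independent_local iF.
have xF : x \notin F by apply/negP => /Fxyz; rewrite xy andbF.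
have yF : y \notin F by apply/negP => /Fxyz; rewrite esym xy.
have zF : z \notin F by apply/negP => /Fxyz; rewrite zx.
(* The default value of [nth] supplies the last term [F] of the decreasing sequence and everything
   after it. *)
have [|||Q chQ] := chainP 1 (nth F [:: x |: F]).
- by case=> [|[|i]] //=; rewrite subsetU1.
- by case=> [|[|i]] //=; apply: independentU1 => // w /Fxyz /andP[].
- by case=> // _; rewrite /= properE subsetU1 subUset sub1set (negPf xF).
have [M [a [aM reg]]] := cm_regular_element (cmS P) chQ.
have [r [k aE]] := local_decomp PE aM.
pose m := X x * X y * X z.
(* If [w] is adjacent to a vertex of the triangle, that edge and the opposite side give an element
   of [J]. If [w] is adjacent to [t] in [F], multiply by [X t], a unit in the localization. *)
have m0 w : w \in ~: F -> quot_loc P (X w * m) = 0.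
  rewrite inE => /domF w_dom; apply/quot_loc_eq0.
  have P1 : \bar (1 : S) \notin (P : pred _) by rewrite PE rmorph1 oner_eq0.
  case/or4P: w_dom => [wx|wy|wz|/exists_inP[t tF tw]].
  - exists 1 => //; apply: (edge_sq_mem (a := 1) wx yz); rewrite /m; ring.
  - exists 1 => //; apply: (edge_sq_mem (a := 1) wy zx); rewrite /m; ring.
  - exists 1 => //; apply: (edge_sq_mem (a := 1) wz xy); rewrite /m; ring.
  - exists (X t); first by rewrite PE killX inE tF vertex_var_neq0.
    by apply: (edge_sq_mem (a := X z) tw xy); rewrite /m; ring.
have /reg/quot_loc_eq0[t] : quot_loc P m * a = 0.
  rewrite aE mulrCA -rmorphM mulr_sumr rmorph_sum big1 ?mulr0 //= => w wF.
  by rewrite mulrCA rmorphM /= [m * _]mulrC m0 // mulr0.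
rewrite PE => /eqP tP tJ; apply: tP.
have dDF : [disjoint [set x; y; z] & F].
  rewrite -setI_eq0; apply/eqP/setP => w; rewrite !inE.
  by apply/negP => /andP[/orP[/orP[]|] /eqP->]; apply/negP.
(* Contraction sends [m] to [X x ^+ 3] and [J] into multiples of [X x ^+ 4]. Hence [phi t] is a
   multiple of [X x] and [kill] annihilates [t], although [t] was outside [P]. *)
have [||phi [phiD phiJ phiK]] := @contract_core F [set x; y; z] x iF _ dDF.
- by move=> w w' /Fxyz/and3P[wx wy wz]; rewrite !inE => /orP[/orP[]|] /eqP->.
- by rewrite !inE eqxx.
have [l] := phiJ _ tJ; rewrite /m !rmorphM !phiD ?inE ?eqxx ?orbT // => El.
rewrite -phiK (_ : phi t = l * X x).
  by rewrite rmorphM /= killX inE xF mulr0.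
apply: (mulIf (expf_neq0 3 (vertex_var_neq0 K x))).
transitivity (phi t * (X x * X x * X x)); first by ring.
by rewrite El; ring.
Qed.

Lemma edge_not_cm (F : {set V}) u v p q :
    e u v -> independent e F ->
    {in F, forall w, ~~ e w u && ~~ e w v} ->
    (forall w, w \notin F -> [|| e w u, e w v | [exists t in F, e t w]]) ->
    p \notin F -> q \notin p |: F -> independent e (q |: (p |: F)) ->
  ~ cohen_macaulay_ideal Ji.
Proof.
move=> uv iF Fuv domF pF qF ipq [_ cmS]; have [esym eirr] := e_simple.
have [P [PE chainP]] := independent_local iF.
have uF : u \notin F by apply/negP => /Fuv; rewrite uv andbF.
have vF : v \notin F by apply/negP => /Fuv; rewrite esym uv.
(* Adding [p] and then [q] to [F] yields a chain of length 2, so the dimension is at least 2. *)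
have [|||Q chQ] := chainP 2 (nth F [:: q |: (p |: F); p |: F]).
- case=> [|[|[|i]]] //=; rewrite ?subsetU1 //.
  exact: subset_trans (subsetU1 _ _) (subsetU1 _ _).
- by case=> [|[|[|i]]] //=; apply: independentS ipq; rewrite ?subsetU1.
- case=> [|[|]] // _;
    rewrite /= properE subsetU1 subUset sub1set ?(negPf pF) //.
  by rewrite (negPf qF).
have [M [a [b [aM bM rega regb]]]] := cm_regular_pair (cmS P) chQ.
have [r [k aE]] := local_decomp PE aM.
have [s [l bE]] := local_decomp PE bM.
pose m := X u * X v.
have P1 : \bar (1 : S) \notin (P : pred _) by rewrite PE rmorph1 oner_eq0.
(* Either [w'] is adjacent to [v] and the four variables pair up as the edges [w u] and [w' v], or
   [w'] is adjacent to some [t] in [F] and [X t] is a unit. *)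
have m0 w w' : e w u -> w' \in ~: F -> ~~ e w' u ->
    quot_loc P (X w * X w' * m) = 0.
  rewrite inE => wu /domF w_dom /negPf w'u; apply/quot_loc_eq0.
  case/or3P: w_dom => [|w'v|/exists_inP[t tF tw']]; first by rewrite w'u.
  - exists 1 => //; apply: (edge_sq_mem (a := 1) wu w'v); rewrite /m; ring.
  - exists (X t); first by rewrite PE killX inE tF vertex_var_neq0.
    by apply: (edge_sq_mem (a := X w) tw' uv); rewrite /m; ring.
(* The parts of an element of [P] in [Q1] (neighbours of [u]) and in [Q2] (other vertices outside
   [F]). *)
pose g1 (k : V -> S) := \sum_(w in ~: F | e w u) k w * X w.
pose g2 (k : V -> S) := \sum_(w in ~: F | ~~ e w u) k w * X w.
have gE k' : \sum_(w in ~: F) k' w * X w = g1 k' + g2 k'.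
  exact: bigID.
have g1w k' w' : w' \in ~: F -> ~~ e w' u -> quot_loc P (X w' * g1 k' * m) = 0.
  move=> w'F w'u; rewrite mulr_sumr mulr_suml rmorph_sum.
  rewrite big1 //= => w /andP[_ wu].
  rewrite (_ : _ * _ = k' w * (X w * X w' * m)); last by ring.
  by rewrite rmorphM /= m0 // mulr0.
have g2w k' w : e w u -> quot_loc P (X w * g2 k' * m) = 0.
  move=> wu; rewrite mulr_sumr mulr_suml rmorph_sum.
  rewrite big1 //= => w' /andP[w'F w'u].
  rewrite (_ : _ * _ = k' w' * (X w * X w' * m)); last by ring.
  by rewrite rmorphM /= m0 // mulr0.
have g12 k1 k2 : quot_loc P (g1 k1 * g2 k2 * m) = 0.
  rewrite mulr_suml mulr_suml rmorph_sum big1 //= => w /andP[_ wu].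
  by rewrite -!mulrA rmorphM /= [X w * _]mulrA g2w ?mulr0.
have ql3 (t t' : localization P) f g h : quot_loc P (f * g * h) = 0 ->
    t * quot_loc P f * (t' * quot_loc P g) * quot_loc P h = 0.
  rewrite !rmorphM => E; transitivity (t * t' *
    (quot_loc P f * quot_loc P g * quot_loc P h)); first by ring.
  by rewrite E mulr0.
have ql3' (t' : localization P) f g h : quot_loc P (f * g * h) = 0 ->
    quot_loc P f * (t' * quot_loc P g) * quot_loc P h = 0.
  by move/(ql3 1 t'); rewrite mul1r.
rewrite gE rmorphD mulrDr in aE; rewrite gE rmorphD mulrDr in bE.
rewrite aE in rega regb; rewrite bE in regb.
have [c [cv cu]] := regular_pair_glue (ql3 _ _ _ _ _ (g12 k l))
  (ql3 _ _ _ _ _ (g12 l k)) rega regb.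
(* As [v] is a neighbour of [u], [X v] kills [g2 k * m], so it kills [c]. As [u] is not its own
   neighbour, [X u] kills [g1 k * m], so [c] and [m] agree after multiplication by [X u]. *)
have {}cv := cv _ (ql3' _ _ _ _ (g2w k v _)).
have {}cu := cu _ (ql3' _ _ _ _ (g1w k u _ _)).
have [g [d [t [dP td cE]]]] := quot_loc_frac c.
have dc : quot_loc P d * c = quot_loc P g.
  by rewrite cE mulrA [_ * t]mulrC td mul1r.
have /quot_loc_eq0[t1 t1P t1J] : quot_loc P (X v * g) = 0.
  by rewrite rmorphM /= -dc mulrCA cv ?mulr0 // esym.
have /quot_loc_eq0[t2 t2P t2J] : quot_loc P (X u * (g - d * m)) = 0.
  rewrite rmorphM rmorphB mulrBr [X in _ - _ * X]rmorphM /= -dc.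
  rewrite mulrCA cu ?inE ?eirr //.
  by rewrite mulrCA subrr.
have dDF : [disjoint [set u; v] & F].
  rewrite -setI_eq0; apply/eqP/setP => w; rewrite !inE.
  by apply/negP => /andP[/orP[] /eqP->]; apply/negP.
have [||phi [phiD phiJ phiK]] := @contract_core F [set u; v] u iF _ dDF.
- by move=> w w' /Fuv/andP[wu wv]; rewrite !inE => /orP[] /eqP->.
- by rewrite !inE eqxx.
have [k1] := phiJ _ t1J; rewrite !rmorphM !phiD ?inE ?eqxx ?orbT // => E1.
have [k2] := phiJ _ t2J.
rewrite rmorphM rmorphM rmorphB rmorphM /m rmorphM.
rewrite !phiD ?inE ?eqxx ?orbT // => E2.
(* Eliminating [phi g] between [E1] and [E2] leaves [phi (t1 * t2 * d) * X u ^+ 3] as a multiple of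
   [X u ^+ 4]. So [kill] annihilates [t1 * t2 * d], a product of elements outside the prime. *)
have : kill (~: F) (t1 * t2 * d) = 0.
  rewrite -phiK (_ : phi _ = (phi t2 * k1 - phi t1 * k2) * X u).
    by rewrite rmorphM /= killX inE uF mulr0.
  rewrite !rmorphM; apply: (mulIf (expf_neq0 3 (vertex_var_neq0 K u))).
  transitivity (phi t2 * (phi t1 * (X u * phi g)) -
    phi t1 * (phi t2 * (X u * (phi g - phi d * (X u * X u))))); first by ring.
  by rewrite E1 E2; ring.
rewrite !PE in t1P t2P dP.
by apply/eqP; rewrite !rmorphM !mulf_neq0.
Qed.

End LocalCriteria.

(** * Independent sets, leaves and cycles in graphs *)

Section GraphLemmas.
Variables (V : finType) (e : rel V).
Hypothesis e_simple : simple_graph e.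

(** Later [A] consists of the vertices not adjacent to a chosen edge or triangle, so domination is
    only required inside [A]. An undominated vertex of [A] could be added to [F]. *)
Lemma maximal_independent (A F0 : {set V}) : F0 \subset A -> independent e F0 ->
  exists F : {set V}, [/\ F0 \subset F, F \subset A, independent e F
    & forall w, w \in A -> w \notin F -> [exists t in F, e t w]].
Proof.
move=> F0A iF0; pose Q (F : {set V}) := (F \subset A) && `[< independent e F >].
have [|F /maxsetP[/andP[FA /asboolP iF] Fmax] F0F] := @maxset_exists _ Q F0.
  by rewrite /Q F0A; apply/asboolP.
exists F; split=> // w wA; apply: contraR => /exists_inPn Fw.
rewrite -(Fmax (w |: F)) ?setU11 ?subsetU1 //.
rewrite /Q subUset sub1set wA FA; apply/asboolP.
exact: independentU1.
Qed.

(** Otherwise [[set a; b]] is closed under adjacency, hence by connectedness it is the whole vertex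
    set, and there is just one edge. *)
Lemma third_vertex a b : connected e -> (1 < #|edges e|)%N -> e a b ->
  exists2 c, c \notin [set a; b] & e a c || e b c.
Proof.
have [esym eirr] := e_simple.
move=> conn e_edges ab; apply: contrapT => no_c; move: e_edges.
have cl : closed e [set a; b].
  have clS v w : e v w -> v \in [set a; b] -> w \in [set a; b].
    move=> vw; apply: contraLR => wab; apply/negP; rewrite !inE => vab.
    by apply: no_c; exists w => //; case/orP: vab => /eqP <-; rewrite vw ?orbT.
  by move=> v w vw; apply/idP/idP; apply: clS => //; rewrite esym.
have allab v : v \in [set a; b].
  by rewrite -(closed_connect cl (conn a v)) !inE eqxx.
rewrite ltnNge -(cards1 [set a; b]); apply/negP/negPn/subset_leq_card.
apply/subsetP => _ /imsetP[[v w] /= vw ->]; rewrite inE; apply/eqP/setP => x.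
have := allab v; have := allab w; have := allab x; rewrite !inE in vw *.
have nvw : v != w by apply: contraTneq vw => ->; rewrite /= eirr.
move=> -> /orP[]/eqP Ew /orP[]/eqP Ev; move: nvw (allab x);
  rewrite Ew Ev ?eqxx // !inE //.
by rewrite orbC.
Qed.

(** Without leaves, the first vertex of a path has a neighbour other than the second vertex; it
    either prolongs the path or closes a cycle. *)
Lemma cycle_or_leaf : no_isolated e -> V ->
  (exists c, graph_cycle e c) \/
  (exists v u, e v u /\ forall w, e v w -> w = u).
Proof.
have [esym eirr] := e_simple; move=> noiso v0.
have [|no_cycle] := pselect (exists c, graph_cycle e c); first by left.
right; apply: contrapT => no_leaf.
have next_nbr v u : e v u -> exists2 w, e v w & w != u.
  move=> vu; apply: contrapT => no_w; apply: no_leaf.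
  exists v, u; split=> // w vw.
  by apply/eqP; apply: contrapT => /negP wu; apply: no_w; exists w.
(* The list [x :: p] has [n.+2] distinct vertices, which is absurd for [n = #|V|]. *)
have paths n : exists x p, [/\ path e x p, uniq (x :: p) & size p = n.+1].
  elim: n => [|n [x [p [xp Up sp]]]].
    have [w v0w] := noiso v0; exists v0, [:: w]; split=> //=; rewrite ?v0w //.
    by rewrite inE andbT; apply: contraTneq v0w => ->; rewrite eirr.
  case: p => [|y p] // in xp Up sp *.
  case/andP: xp => xy; rewrite -/(path e y p) => yp.
  have [w xw wy] := next_nbr _ _ xy.
  have [wp|wp] := boolP (w \in x :: y :: p); last first.
    by exists w, (x :: y :: p); split;
      [rewrite /= esym xw xy | rewrite cons_uniq wp | rewrite -sp].
  have wp' : w \in p.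
    move: wp; rewrite !inE (negPf wy) /=; have [wx|//] := eqVneq w x.
    by rewrite wx eirr in xw.
  case/path.splitP: wp' yp Up {sp wp} => p1 p2 yp Up; case: no_cycle.
  exists (x :: y :: rcons p1 w); split; last by rewrite /= size_rcons.
  apply/andP; split.
    move: yp; rewrite cat_path => /andP[yp _].
    by rewrite /= rcons_path last_rcons xy yp esym xw.
  by move: Up; rewrite -!cat_cons cat_uniq => /andP[].
have [x [p [_ Up sp]]] := paths #|V|.
have := max_card [in x :: p]; rewrite (card_uniqP Up) /= sp.
by rewrite ltnNge leqnSn.
Qed.

(** Induction on the length: a chord cuts off a strictly shorter cycle, until length 3 is
    reached. *)
Lemma chordal_triangle : chordal e -> (exists c, graph_cycle e c) ->
  exists x y z, [/\ e x y, e y z & e z x].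
Proof.
have [esym eirr] := e_simple; move=> chord_e [c].
have [n] := ubnP (size c); elim: n c => // n IHn c.
rewrite ltnS => cn cyc; have [/andP[ec Uc] c3] := cyc.
have [c4|] := leqP 4 (size c); last first.
  case: c {cn cyc Uc} ec c3 => [|x [|y [|z [|? ?]]]] //= /and4P[xy yz zx _] _ _.
  by exists x, y, z.
have [v [w [vc wc vw nv nw]]] := chord_e _ cyc c4.
have [i s Es] := rot_to vc.
have ws : w \in s.
  move: wc; rewrite -(mem_rot i) Es inE => /orP[/eqP wv|//].
  by rewrite wv eirr in vw.
move: nv nw; rewrite -(next_rot i Uc) -(next_rot i Uc w).
move: cn; rewrite -(size_rot i) => cn.
move: ec; rewrite -(rot_cycle i) => ec.
move: Uc; rewrite -(rot_uniq i).
rewrite {}Es in cn ec *; case/path.splitP: ws cn ec => p1 p2 cn ec Uc nv nw.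
(* The cycle now reads [v], [p1], [w], [p2]. The two conditions on [next] make both arcs nonempty:
   [p1] so that [v], [p1], [w] is again a cycle, [p2] so that it is shorter. *)
have p1_gt0 : (0 < size p1)%N.
  by case: p1 nv {nw cn ec Uc} => //=; rewrite !eqxx.
have p2_gt0 : (0 < size p2)%N.
  case: p2 nw Uc {cn ec nv} => //; rewrite cats0 -rcons_cons => nw Uc.
  move: nw; rewrite -(next_rot (size (v :: p1)) Uc).
  by rewrite -cats1 rot_size_cat /= !eqxx.
apply: (IHn (v :: rcons p1 w)).
  rewrite /= size_rcons; apply: leq_trans cn.
  by rewrite /= size_cat size_rcons ltnS -[X in (X < _)%N]addn0 ltn_add2l.
split; last by rewrite /= size_rcons.
apply/andP; split; last by move: Uc; rewrite -cat_cons cat_uniq => /andP[].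
move: ec; rewrite /= rcons_cat cat_path => /andP[ep _].
by rewrite rcons_path ep last_rcons esym.
Qed.

End GraphLemmas.

(** * Choosing the independent set for each class of graphs *)

Section SecondPower.
Variables (K : fieldType) (V : finType) (e : rel V).
Hypothesis e_simple : simple_graph e.
Local Notation J := (ideal_mul (edge_ideal K e) (edge_ideal K e)).

Lemma triangle_sq_not_cm x y z :
  e x y -> e y z -> e z x -> ~ cohen_macaulay_ideal J.
Proof.
move=> xy yz zx; pose A := [set w | [&& ~~ e w x, ~~ e w y & ~~ e w z]].
have [|w|F [_ FA iF Fmax]] := @maximal_independent _ _ e_simple A set0.
- exact: sub0set.
- by rewrite inE.
apply: (@triangle_not_cm _ _ _ e_simple F x y z) => // w.
  by move/(subsetP FA); rewrite inE.
move=> wF; have := Fmax w; rewrite inE.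
by case: (e w x); case: (e w y); case: (e w z) => //= /(_ isT wF).
Qed.

(** The dominating edge is [x z]. The vertices [y] and [z], both adjacent to [x] and hence outside
    [F], can be added to [F]: the only neighbour of [y] is [x], and [F] avoids the neighbours of
    [z]. *)
Lemma leaf_sq_not_cm x y z :
    e x y -> e x z -> y != z -> (forall w, e y w -> w = x) ->
  ~ cohen_macaulay_ideal J.
Proof.
have [esym eirr] := e_simple; move=> xy xz yz leafy.
pose A := [set w | ~~ e w x && ~~ e w z].
have [|w|F [_ /subsetP FA iF Fmax]] := @maximal_independent _ _ e_simple A set0.
- exact: sub0set.
- by rewrite inE.
have xF : x \notin F by apply/negP => /FA; rewrite inE xz andbF.
have yF : y \notin F by apply/negP => /FA; rewrite inE esym xy.
have zF : z \notin F by apply/negP => /FA; rewrite inE esym xz.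
apply: (@edge_not_cm _ _ _ e_simple F x z y z) => // [w /FA|w wF||].
- by rewrite inE.
- have := Fmax w; rewrite inE.
  by case: (e w x); case: (e w z) => //= /(_ isT wF).
- by rewrite !inE eq_sym negb_or yz.
- apply: independentU1 => //; first apply: independentU1 => //.
    move=> w wF; apply/negP; rewrite esym => /leafy wx.
    by rewrite -wx wF in xF.
  move=> w /setU1P[->|/FA]; last by rewrite inE => /andP[].
  by apply/negP => /leafy zx; rewrite zx eirr in xz.
Qed.

Lemma bipartite_sq_not_cm : no_isolated e -> (1 < #|edges e|)%N ->
  connected e -> bipartite e -> ~ cohen_macaulay_ideal J.
Proof.
have [esym eirr] := e_simple; move=> noiso e_edges conn [B eB].
pose side v := v \in B.
have sideN v w : e v w -> side v = ~~ side w.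
  by move=> /eB; rewrite /side; case: (v \in B); case: (w \in B).
have side_indep b (F : {set V}) :
    (forall w, w \in F -> side w = b) -> independent e F.
  move=> Fb v w /Fb vb /Fb wb; apply/negP => /sideN.
  by rewrite vb wb; case: b {vb wb Fb}.
(* If the neighbourhood of [b] lies in that of [v], take a common neighbour [u] and the edge [u v].
   A set avoiding the neighbours of [v] avoids those of [b], so [b] and [v] can be added. *)
have [[b [v [bv Nbv]]]|antichain] :=
  pselect (exists b v, b != v /\ forall w, e w b -> e w v).
  have [u] := noiso b; rewrite esym => ub; have uv := Nbv _ ub.
  pose A := [set w | ~~ e w u && ~~ e w v].
  pose F0 := [set w | (side w == side u) && ~~ e w v].
  have [||F [/subsetP F0F /subsetP FA iF Fmax]] :=
      @maximal_independent _ _ e_simple A F0.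
  - apply/subsetP => w; rewrite !inE => /andP[/eqP wu ->]; rewrite andbT.
    by apply/negP => /sideN; rewrite wu; case: (side u).
  - by apply: (side_indep (side u)) => w; rewrite inE => /andP[/eqP].
  have bF : b \notin F by apply/negP => /FA; rewrite inE esym ub.
  have vF : v \notin F by apply/negP => /FA; rewrite inE esym uv.
  apply: (@edge_not_cm _ _ _ e_simple F u v b v) => // [w /FA|w wF||].
  - by rewrite inE.
  - have := Fmax w; rewrite inE.
    by case: (e w u); case: (e w v) => //= /(_ isT wF).
  - by rewrite !inE eq_sym negb_or bv.
  - apply: independentU1 => //; first apply: independentU1 => //.
      move=> w /FA; rewrite inE => /andP[_ /negP wv].
      by apply/negP => /Nbv.
    move=> w /setU1P[->|/FA]; last by rewrite inE => /andP[].
    apply/negP => /sideN Eb; have := sideN _ _ ub.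
    by rewrite (sideN _ _ uv) Eb; case: (side v).
have [v [u [u' [vu vu' uu']]]] : exists v u u', [/\ e v u, e v u' & u != u'].
  have [v0 _] : exists v : V, true.
    have /card_gt0P[_ /imsetP[[v w] _ _]] : (0 < #|edges e|)%N by exact: ltnW.
    by exists v.
  have [w v0w] := noiso v0.
  have [c] := third_vertex e_simple conn e_edges v0w.
  rewrite !inE negb_or => /andP[cv cw].
  case/orP=> ec; first by exists v0, w, c; rewrite eq_sym.
  by exists w, v0, c; rewrite esym eq_sym.
(* With no inclusions among neighbourhoods, each vertex other than [v] on the side of [v] has a
   neighbour not adjacent to [v], which is in [F]. Vertices on the side of [u] outside [F] are
   adjacent to [v]; [u] and [u'] are two of them. *)
pose F := [set w | (side w == side u) && ~~ e w v].
have Fu w : w \in F -> side w = side u by rewrite inE => /andP[/eqP].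
have uv : e u v by rewrite esym.
have su' : side u' = side u.
  by apply: negb_inj; rewrite -(sideN _ _ vu) -(sideN _ _ vu').
apply: (@edge_not_cm _ _ _ e_simple F u v u u') => //.
- exact: side_indep Fu.
- move=> w wF; move: (wF); rewrite inE => /andP[_ ->]; rewrite andbT.
  by apply/negP => /sideN; rewrite Fu //; case: (side u).
- move=> w; rewrite inE negb_and negbK => /orP[wu|->]; last by rewrite orbT.
  have [->|wv] := eqVneq w v; first by rewrite vu.
  apply/or3P/Or33/exists_inP; apply: contrapT => no_t; apply: antichain.
  exists w, v; split=> // t tw; apply: contrapT => /negP tv; apply: no_t.
  exists t => //; rewrite inE tv andbT (sideN _ _ tw).
  by move: wu; case: (side w); case: (side u).
- by rewrite inE uv andbF.
- by rewrite !inE esym vu' andbF orbF eq_sym.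
- by apply: (side_indep (side u)) => w /setU1P[->|/setU1P[->|/Fu]].
Qed.

End SecondPower.

(** There is a leaf, and [third_vertex] gives its neighbour a second neighbour. *)
Lemma acyclic_sq_not_cm (K : fieldType) (V : finType) (e : rel V) :
    simple_graph e -> no_isolated e -> (1 < #|edges e|)%N -> connected e ->
    ~ (exists c, graph_cycle e c) ->
  ~ cohen_macaulay_ideal (ideal_mul (edge_ideal K e) (edge_ideal K e)).
Proof.
move=> e_simple noiso e_edges conn no_cycle.
have /card_gt0P[_ /imsetP[[v0 _] _ _]] : (0 < #|edges e|)%N by exact: ltnW.
have [//|[v [u [vu leafv]]]] := cycle_or_leaf e_simple noiso v0.
have [c] := third_vertex e_simple conn e_edges vu.
rewrite !inE negb_or => /andP[cv cu] /orP[/leafv cu'|uc].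
  by rewrite cu' eqxx in cu.
have [esym _] := e_simple.
by apply: (leaf_sq_not_cm e_simple (x := u) (y := v) (z := c)) => //;
  rewrite 1?esym // eq_sym.
Qed.

Theorem corollary3p5 (K : fieldType) (V : finType) (e : rel V)
    (e_simple : simple_graph e) (e_noiso : no_isolated e)
    (e_edges : (1 < #|edges e|)%N) :
  [/\ whiskered e ->
        ~ cohen_macaulay_ideal (ideal_mul (edge_ideal K e) (edge_ideal K e)),
      tree e ->
        ~ cohen_macaulay_ideal (ideal_mul (edge_ideal K e) (edge_ideal K e)),
      connected e /\ chordal e ->
        ~ cohen_macaulay_ideal (ideal_mul (edge_ideal K e) (edge_ideal K e))
    & [/\ connected e, cohen_macaulay_graph K e & bipartite e] ->
        ~ cohen_macaulay_ideal (ideal_mul (edge_ideal K e) (edge_ideal K e))].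
Proof.
split=> [[W [h [_ hnoiso [f [g fK gK] ef]]]]|[conn acyc]|[conn ch]
  |[conn _ bip]].
- have /card_gt0P[_ /imsetP[[v0 _] _ _]] : (0 < #|edges e|)%N by exact: ltnW.
  have i : W by case: (g v0).
  have [j ij] := hnoiso i.
  (* The whisker end over [i] is a leaf, and its neighbour is also adjacent to the base vertex
     [j]. *)
  apply: (leaf_sq_not_cm e_simple
    (x := f (inl i)) (y := f (inr i)) (z := f (inl j))).
  + by rewrite ef /= eqxx.
  + by rewrite ef.
  + by rewrite (can_eq fK).
  + move=> w; rewrite -(gK w) ef; by case: (g w) => //= k /eqP ->.
- by apply: acyclic_sq_not_cm => // -[c]; exact: acyc.
- have [cyc|] := pselect (exists c, graph_cycle e c).
    have [x [y [z [xy yz zx]]]] := chordal_triangle e_simple ch cyc.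
    exact: (triangle_sq_not_cm e_simple xy yz zx).
  exact: acyclic_sq_not_cm.
- exact: bipartite_sq_not_cm.
Qed.
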